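(* Let $\sigma : A \to A^+$ be a tame and $l$-primitive substitution. Then every letter in $A$ is legal. Particularly, $\mathcal{L}(X_{\sigma}) = \mathcal{L}(\sigma)$.
   Context: An alphabet $A$ is a finite set with at least two elements (one-letter alphabets are excluded); its elements are letters. $A^+$ is the set of all words over $A$ of positive finite length, $\epsilon$ is the empty word, $A^* = A^+ \cup \{\epsilon\}$, and $|w|$ is the length of $w$. A word $v$ is a subword (factor) of $w$ if $w = u v u'$ for some $u,u' \in A^*$. A map $\sigma : A \to A^+$ extends to $\sigma : A^* \to A^*$ by concatenation and $\sigma(\epsilon)=\epsilon$. Put $A_l := \{a \in A : \lim_{n\to\infty} |\sigma^n(a)| = \infty\}$ and $A_s := A \setminus A_l$. A letter $b \in A$ is isolated if $b \in A_s$ and $b$ does not appear in any $\sigma^n(a)$ with $a \in A_l$, $n \ge 1$; $A_{\mathrm{iso}}$ is the set of isolated letters. $\sigma$ is called a substitution if $A_l \ne \emptyset$ and $A_{\mathrm{iso}} = \emptyset$. The language $\mathcal{L}(\sigma) \subseteq A^*$ is the set of all words (including $\epsilon$) that are subwords of $\sigma^n(a)$ for some $a \in A$ and $n \ge 1$. For $x \in A^{\mathbb{Z}}$ and integers $s \le t$, $x[s,t] := x(s)x(s+1)\cdots x(t)$. Define $X_\sigma := \{x \in A^{\mathbb{Z}} : x[s,t] \in \mathcal{L}(\sigma) \text{ for all integers } s<t\}$. For $X \subseteq A^{\mathbb{Z}}$, $\mathcal{L}(X)$ is the set consisting of $\epsilon$ and all words $x[s,t]$ with $x \in X$ and integers $s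 \le t$. A word $u$ is legal if $u \in \mathcal{L}(X_\sigma)$. A substitution $\sigma$ is $l$-primitive if there exists $n \ge 1$ such that for all $a,b \in A_l$, $a$ is a letter in $\sigma^n(b)$. A letter $a \in A_l$ is left-isolated if there is $n \ge 1$ with $\sigma^n(a) = u\,a\,w$ for some $u \in A_s^+$ and $w \in A^*$; it is right-isolated if there is $n \ge 1$ with $\sigma^n(a) = w\,a\,u$ for some $w \in A^*$ and $u \in A_s^+$ (here $A_s^+$ is the set of nonempty words over $A_s$). $\sigma$ is tame if no letter in $A_l$ is left-isolated and no letter in $A_l$ is right-isolated. *)

(* Defs.v *)
From mathcomp Require Import all_boot all_order all_algebra.
From mathcomp Require Import all_classical.

Set Implicit Arguments.
Unset Strict Implicit.
Unset Printing Implicit Defensive.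

Import Order.TTheory GRing.Theory Num.Theory.

Local Open Scope classical_set_scope.
Local Open Scope ring_scope.

(* Finite words over [A] are sequences in [seq A]; [infix v w] says that [v] is
   a subword (factor) of [w]. *)

Section Substitutions.
Context {A : finType}.
Implicit Types (sigma : A -> seq A) (a b : A) (u v w : seq A) (n : nat).

(* [sigma] takes its values in A^+ *)
Definition nonerasing sigma := forall a, sigma a != [::].

Definition extend sigma w : seq A := flatten [seq sigma a | a <- w].

Definition power sigma n a : seq A := iter n (extend sigma) [:: a].

Definition long_letters sigma : set A :=
  [set a | size (power sigma n a) @[n --> \oo] --> \oo].

Definition short_letters sigma : set A := ~` long_letters sigma.

Definition isolated_letters sigma : set A :=
  [set b | short_letters sigma b /\
    forall a n, long_letters sigma a -> (1 <= n)%N -> b \notin power sigma n a].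

Definition is_substitution sigma :=
  [/\ nonerasing sigma,
      long_letters sigma !=set0 &
      isolated_letters sigma = set0].

Definition language sigma : set (seq A) :=
  [set w | exists a n, (1 <= n)%N /\ infix w (power sigma n a)].

(* x[s,t] = x(s) x(s+1) ... x(t); only meaningful for s <= t *)
Definition window (x : int -> A) (s t : int) : seq A :=
  [seq x (s + i%:Z) | i <- iota 0 `|t - s|%N.+1].

Definition subshift sigma : set (int -> A) :=
  [set x | forall s t : int, s < t -> language sigma (window x s t)].

Definition shift_language (X : set (int -> A)) : set (seq A) :=
  [set w | w = [::] \/
    exists x (s t : int), [/\ X x, s <= t & w = window x s t]].

Definition legal sigma w := shift_language (subshift sigma) w.

Definition l_primitive sigma :=
  exists n, (1 <= n)%N /\
    forall a b, long_letters sigma a -> long_letters sigma b ->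
      a \in power sigma n b.

Definition nonempty_short_word sigma u :=
  u != [::] /\ [set` u] `<=` short_letters sigma.

Definition left_isolated sigma a :=
  exists n u w, [/\ (1 <= n)%N, nonempty_short_word sigma u &
    power sigma n a = u ++ a :: w].

Definition right_isolated sigma a :=
  exists n w u, [/\ (1 <= n)%N, nonempty_short_word sigma u &
    power sigma n a = w ++ a :: u].

Definition tame sigma :=
  forall a, long_letters sigma a ->
    ~ left_isolated sigma a /\ ~ right_isolated sigma a.

End Substitutions.

(* Main.v *)
Require Import Defs.
From mathcomp Require Import all_boot all_order all_algebra.
From mathcomp Require Import all_classical.
From mathcomp Require Import zify.

(** A bi-infinite word all of whose windows lie in [language sigma] can be grown
    letter by letter around any word that extends on both sides inside the
    language.  By applying powers of [sigma], every word of the language extends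
    as soon as every letter does.  A long letter does because
    [l]-primitivity puts it in an image of the middle one of three long letters
    of some word [power sigma n a]; tameness is what provides several long
    letters when there is only one of them in the alphabet.  A short letter is
    not isolated, so it lies in an image of a long one. *)

Lemma mem_split (T : eqType) (x : T) (s : seq T) :
  x \in s -> exists u v, s = u ++ x :: v.
Proof. by case/splitPr=> u v; exists u, v. Qed.

Section Iterates.
Context {A : finType} (sigma : A -> seq A).
Implicit Types (u v w : seq A) (a b : A) (n m : nat).

Lemma iter_extend_cat n u v :
  iter n (extend sigma) (u ++ v)
    = iter n (extend sigma) u ++ iter n (extend sigma) v.
Proof. by elim: n => //= n ->; rewrite /extend map_cat flatten_cat. Qed.

Lemma iter_extend_cons n a w :
  iter n (extend sigma) (a :: w) = power sigma n a ++ iter n (extend sigma) w.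
Proof. exact: (iter_extend_cat n [:: a]). Qed.

Lemma powerD n m a :
  power sigma (n + m) a = iter n (extend sigma) (power sigma m a).
Proof. exact: iterD. Qed.

Lemma iter_extend_neq0 n w :
  nonerasing sigma -> w != [::] -> iter n (extend sigma) w != [::].
Proof.
move=> ne w0; elim: n => //= n; case: (iter _ _ _) => //= a s _.
by rewrite /extend /=; have := ne a; case: (sigma a).
Qed.

Lemma language_infix u w : infix u w -> language sigma w -> language sigma u.
Proof.
by move=> uw [a [n [n0 wn]]]; exists a, n; split=> //; exact: infix_trans wn.
Qed.

Lemma language_iter n w :
  language sigma w -> language sigma (iter n (extend sigma) w).
Proof.
move=> [a [m [m0 /infixP[p [s pws]]]]]; exists a, (n + m)%N; split.
  by rewrite addn_gt0 m0 orbT.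
by rewrite powerD pws !iter_extend_cat infix_catl // infix_catr ?infix_refl.
Qed.

(** Arbitrary nonempty words on both sides, rather than single letters, make this property pass to
    images under [extend sigma] when [sigma] is nonerasing. *)
Definition two_sided w :=
  exists u v, [/\ u != [::], v != [::] & language sigma (u ++ w ++ v)].

Lemma two_sided_infix u w : infix u w -> two_sided w -> two_sided u.
Proof.
case/infixP=> p [s ->] [l [r [l0 r0 L]]]; exists (l ++ p), (s ++ r); split.
- by case: l l0 {L}.
- by case: s {L} => //=; case: r r0.
- by move: L; rewrite !catA.
Qed.

Lemma two_sided_iter n w : nonerasing sigma ->
  two_sided w -> two_sided (iter n (extend sigma) w).
Proof.
move=> ne [u [v [u0 v0 L]]].
exists (iter n (extend sigma) u), (iter n (extend sigma) v).
by split; rewrite ?iter_extend_neq0 // -!iter_extend_cat; exact: language_iter.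
Qed.

End Iterates.

Section Growing.
Context {A : finType} (sigma : A -> seq A) (f : seq A -> seq A).
Hypothesis f_surround : forall w, exists a b, f w = a :: rcons w b.
Context (d : A) (w : seq A).
Hypothesis w_neq0 : w != [::].

Let W n := iter n f w.

Lemma size_surround n : size (W n) = (n.*2 + size w)%N.
Proof.
elim: n => //= n IH; have [a [b ->]] := f_surround (W n).
by rewrite /= size_rcons IH; lia.
Qed.

(** Each step puts one letter in front, so an old entry moves up by one index per step. *)
Lemma nth_surround n k i : (i < size (W n))%N ->
  nth d (W (k + n)) (k + i) = nth d (W n) i.
Proof.
move=> lt_i; elim: k => //= k IH; have [a [b ->]] := f_surround (W (k + n)).
by rewrite /= nth_rcons ifT // size_surround; move: lt_i; rewrite size_surround; lia.
Qed.

(* [W n] occupies the positions [-n, n + size w - 1]. *)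
Definition grown (z : int) : A := nth d (W `|z|) `|(z + Posz `|z|)%R|.

(** The index [z + |z|] is at most [2|z|], hence inside [W |z|] because [w] is nonempty. The longer
    of [W n] and [W |z|] then arises from the shorter by further steps, so both show the same letter
    at position [z]. *)
Lemma grownE n i (z : int) : (i < size (W n))%N -> (z + Posz n)%R = Posz i ->
  grown z = nth d (W n) i.
Proof.
move=> lt_i zi; rewrite /grown; set j := `|(z + _)%R|%N.
have w0 : (0 < size w)%N by case: (w) w_neq0.
have [le_nz|lt_zn] := leqP n `|z|.
  rewrite -(nth_surround n (`|z| - n) i lt_i) subnK //.
  by congr nth; rewrite /j; lia.
rewrite -(nth_surround `|z| (n - `|z|) j); last by rewrite size_surround /j; lia.
rewrite subnK; last exact: ltnW.
by congr nth; rewrite /j; lia.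
Qed.

Lemma grown_window (s t : int) : (s <= t)%R ->
  exists n, infix (window grown s t) (W n).
Proof.
(* [W n] covers at least the positions from [-n] to [n], hence both [s] and [t]. *)
move=> le_st; set n := maxn `|s| `|t|; exists n.
have w0 : (0 < size w)%N by case: (w) w_neq0.
have -> : window grown s t
    = take `|(t - s)%R|.+1 (drop `|(s + Posz n)%R| (W n)).
  have sz : (`|(t - s)%R|.+1 <= size (drop `|(s + Posz n)%R| (W n)))%N.
    by rewrite size_drop size_surround; lia.
  apply: (@eq_from_nth _ d); first by rewrite size_map size_iota size_takel.
  rewrite size_map size_iota => i lt_i.
  rewrite (nth_map 0%N) ?size_iota // nth_iota // nth_take // nth_drop add0n.
  by apply: grownE; rewrite ?size_surround; lia.
by rewrite (infix_trans (infix_take _ _)) // infix_drop.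
Qed.

Lemma grown_window0 : window grown 0%R (Posz (size w).-1) = w.
Proof.
have w0 : (0 < size w)%N by case: (w) w_neq0.
have szE : `|(Posz (size w).-1 - 0)%R|.+1 = size w by lia.
apply: (@eq_from_nth _ d); rewrite size_map size_iota szE // => i lt_i.
rewrite (nth_map 0%N) ?size_iota ?szE // nth_iota // add0n.
by apply: (@grownE 0%N) => //; lia.
Qed.

End Growing.

Lemma legal_of_two_sided {A : finType} (sigma : A -> seq A) :
  (forall w, language sigma w -> two_sided sigma w) ->
  forall w, language sigma w -> legal sigma w.
Proof.
move=> ext w Lw; have [->|w0] := eqVneq w [::]; first by left.
have d : A by case: w w0 {Lw}.
have step v : exists v', (exists a b, v' = a :: rcons v b) /\
    (language sigma v -> language sigma v').
  have [Lv|nLv] := pselect (language sigma v); last first.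
    (* Outside the language the added letters are arbitrary; this makes the step a total
       function. *)
    by exists (d :: rcons v d); split; [exists d, d|].
  have [u [r [u0 r0 L]]] := ext v Lv.
  case/lastP: u u0 L => // u a _; case: r r0 => // b r _ L.
  exists (a :: rcons v b); split=> [|_]; first by exists a, b.
  apply: language_infix L; apply/infixP; exists u, r.
  by rewrite -cats1 -[rcons v b]cats1 /= -!catA.
have [f f_step] := choice step.
have f_surround v : exists a b, f v = a :: rcons v b by case: (f_step v).
have LW n : language sigma (iter n f w).
  by elim: n => //= n; case: (f_step (iter n f w)) => _; apply.
right; exists (grown f d w), 0%R, (Posz (size w).-1).
split; [move=> s t lt_st | by [] | by rewrite grown_window0].
have [n W_n] := grown_window f f_surround d w w0 s t (Order.POrderTheory.ltW lt_st).
exact: language_infix (LW n).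
Qed.

Section LongLetters.
Context {A : finType} (sigma : A -> seq A).
Hypothesis sigma_tame : tame sigma.
Hypothesis sigma_lprim : l_primitive sigma.
Let long := long_letters sigma.

Lemma long_power_big a n : long a ->
  exists m, (1 < size (power sigma (m * n.+1) a))%N.
Proof.
move=> /(_ [set k : nat | (1 < k)%N]%classic)[|N _ HN]; first by exists 2%N.
by exists N; apply: HN; rewrite /= leq_pmulr.
Qed.

(** A long [b] occurs in its own image, so an exponent that works for all pairs can be replaced by
    any positive multiple. This lets it be matched with the exponent of [long_power_big]. *)
Lemma l_primitive_iter : exists n, forall m a b, long a -> long b ->
  a \in power sigma (m.+1 * n.+1) b.
Proof.
have [[|n] [] // _ prim] := sigma_lprim.
exists n; elim=> [|m IH] a b la lb; first by rewrite mul1n; apply: prim.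
have [u [v e]] := mem_split _ _ _ (IH b b lb lb).
rewrite mulSn powerD e iter_extend_cat iter_extend_cons !mem_cat.
by rewrite (prim a b la lb) orbT.
Qed.

Definition two_long (w : seq A) := exists p a q b r,
  [/\ long a, long b & w = p ++ a :: q ++ b :: r].

(** Two distinct long letters both occur in a common image. If [a] is the only long letter, some
    power of it is longer than one letter and contains [a]; were all the other letters short, [a]
    would be left- or right-isolated. *)
Lemma two_long_power : exists n, forall a, long a -> two_long (power sigma n a).
Proof.
have [n prim] := l_primitive_iter.
have [[a [b [la lb ab]]]|one] :=
    pselect (exists a b, [/\ long a, long b & a != b]).
  exists (1 * n.+1)%N => c lc.
  have [u [v e]] := mem_split _ _ _ (prim 0%N a c la lc).
  have := prim 0%N b c lb lc; rewrite e mem_cat inE eq_sym (negbTE ab) /=.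
  case/orP=> /mem_split[p [q ->]]; last by exists u, a, p, b, q.
  by exists p, b, q, a, v; rewrite -catA.
have eq_long a b : long a -> long b -> a = b.
  by move=> la lb; apply/eqP/negPn/negP => ab; apply: one; exists a, b.
have [[a la]|none] := pselect (exists a, long a); last first.
  by exists 0%N => a la; case: none; exists a.
have [m big] := long_power_big a n la.
(* The zeroth power is a single letter, so the exponent is positive. *)
case: m big => // m big.
exists (m.+1 * n.+1)%N => b lb; rewrite -(eq_long a b la lb) {b lb}.
have [u [v e]] := mem_split _ _ _ (prim m a a la la).
have [[x [xu lx]]|su] := pselect (exists x, x \in u /\ long x).
  case/mem_split: xu e => p [q ->] e; exists p, x, q, a, v.
  by rewrite e -catA.
have [[x [xv lx]]|sv] := pselect (exists x, x \in v /\ long x).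
  by case/mem_split: xv e => p [q ->] e; exists u, a, p, x, q.
have [nl nr] := sigma_tame a la; exfalso.
have [u0|u0] := eqVneq u [::]; last first.
  apply: nl; exists (m.+1 * n.+1)%N, u, v; split=> //; split=> // x xu lx.
  by apply: su; exists x.
apply: nr; exists (m.+1 * n.+1)%N, u, v; split=> //; split=> [|x xv lx].
  by apply/negP => /eqP v0; move: big; rewrite e u0 v0.
by apply: sv; exists x.
Qed.

Lemma two_sided_long a : nonerasing sigma -> long a -> two_sided sigma [:: a].
Proof.
move=> ne la; have [n two] := two_long_power.
have [p [b [q [c [r [lb lc e]]]]]] := two a la.
have [p' [b' [q' [c' [r' [lb' lc' e']]]]]] := two b lb.
have [m prim] := l_primitive_iter.
(* In the image of [p ++ b :: q ++ c :: r], the image of [b] puts [b'] to the left of [c'], and the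
   nonempty image of [c] lies to its right. *)
have two_c' : two_sided sigma [:: c'].
  exists (p' ++ b' :: q'), (r' ++ iter n (extend sigma) (q ++ c :: r)).
  split; first by case: (p').
    rewrite iter_extend_cat iter_extend_cons.
    have := iter_extend_neq0 sigma n [:: c] ne isT.
    rewrite -/(power sigma n c).
    by case: (power sigma n c) => //= x s _; case: (r') => //; case: (iter _ _ _).
  have L : language sigma (power sigma n a).
    (* [language] requires a positive exponent; [n = 0] would fit two letters into [[:: a]]. *)
    case: n {two} e {e'} => [e|k _]; last by exists a, k.+1; rewrite infix_refl.
    by move/(congr1 size): e; rewrite /= size_cat /= size_cat /=; lia.
  apply: language_infix (language_iter sigma n _ L).
  have -> : iter n (extend sigma) (power sigma n a)
      = iter n (extend sigma) p
        ++ (p' ++ b' :: q' ++ c' :: r') ++ iter n (extend sigma) (q ++ c :: r).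
    by rewrite e iter_extend_cat iter_extend_cons e'.
  by rewrite infix_catl // /= -!catA /= -!catA /= infix_refl.
have := two_sided_iter sigma (1 * m.+1) _ ne two_c'.
by apply: two_sided_infix; rewrite infix1s; exact: (prim 0%N).
Qed.

End LongLetters.

Lemma two_sided_letter {A : finType} (sigma : A -> seq A) (a : A) :
  is_substitution sigma -> tame sigma -> l_primitive sigma ->
  two_sided sigma [:: a].
Proof.
move=> [ne _ noiso] tm lp.
have [la|sa] := pselect (long_letters sigma a); first exact: two_sided_long.
have [b [n [lb ab]]] : exists b n, long_letters sigma b /\ a \in power sigma n b.
  apply: contrapT => H; have : isolated_letters sigma a; last by rewrite noiso.
  by split=> // b n lb _; apply/negP => ab; apply: H; exists b, n.
have := two_sided_iter sigma n _ ne (two_sided_long sigma tm lp b ne lb).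
apply: two_sided_infix; rewrite infix1s; exact: ab.
Qed.

Lemma language_of_legal {A : finType} (sigma : A -> seq A) (a0 : A) (w : seq A) :
  legal sigma w -> language sigma w.
Proof.
case=> [->|[x [s [t [Xx le_st ->]]]]]; first by exists a0, 1%N; rewrite infix0s.
(* [subshift] only constrains windows with [s < t]. *)
apply: (language_infix _ _ (window x s (t + 1)%R)); last by apply: Xx; lia.
rewrite /window (_ : `|(t + 1 - s)%R| = `|(t - s)%R|.+1); last by lia.
by rewrite -[_.+2]addn1 iotaD map_cat infix_catr ?infix_refl.
Qed.

Theorem proposition3p27 (A : finType) (cardA : (2 <= #|A|)%N)
    (sigma : A -> seq A) (sigma_subst : is_substitution sigma)
    (sigma_tame : tame sigma) (sigma_lprim : l_primitive sigma) :
  (forall a : A, legal sigma [:: a]) /\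
  shift_language (subshift sigma) = language sigma.
Proof.
have [ne _ _] := sigma_subst.
have legalL w : language sigma w -> legal sigma w.
  apply: legal_of_two_sided => {}w [a [n [_ wn]]].
  apply: two_sided_infix wn _; apply: two_sided_iter => //.
  exact: two_sided_letter.
split=> [a|].
  apply: legalL.
  have [u [v [_ _]]] := two_sided_letter sigma a sigma_subst sigma_tame sigma_lprim.
  by apply: language_infix; apply/infixP; exists u, v.
(* Some letter is needed to place the empty word in [language sigma]. *)
have [a0 _] : exists a0 : A, a0 \in A by apply/card_gt0P/(leq_trans _ cardA).
by apply/seteqP; split=> w; [exact: language_of_legal|exact: legalL].
Qed.
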